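(* Let $A$ be a finite set and let $X \subset A^{\mathbb{Z}}$ be a subshift. Then the following conditions are equivalent: (a) $X$ is strongly irreducible; (b) there is an integer $N_0 \geq 0$ such that, for all $u,v \in L(X)$ and for every $N \geq N_0$, there exists a word $w \in A^*$ of length $N$ satisfying $uwv \in L(X)$.
   Context: $A^{\mathbb{Z}}$ is the set of all maps $x \colon \mathbb{Z} \to A$ with the product of the discrete topologies, and $\mathbb{Z}$ acts on it by $(gx)(h) = x(h-g)$. A subshift is a closed $\mathbb{Z}$-invariant subset. $A^*$ is the free monoid of all finite words over $A$ (including the empty word), with concatenation. The language $L(X) \subset A^*$ of $X$ is the set of all words of the form $x(1)x(2)\cdots x(n)$ with $x \in X$ and $n \geq 0$. For subsets $\Omega,\Delta \subset \mathbb{Z}$ put $\Omega^{+\Delta} = \{g \in \mathbb{Z} : (g+\Delta) \cap \Omega \neq \varnothing\}$. For a finite subset $\Delta \subset \mathbb{Z}$, $X$ is $\Delta$-irreducible if for all finite subsets $\Omega_1,\Omega_2 \subset \mathbb{Z}$ with $\Omega_1^{+\Delta} \cap \Omega_2 = \varnothing$ and all $x_1,x_2 \in X$ there exists $x \in X$ coinciding with $x_1$ on $\Omega_1$ and with $x_2$ on $\Omega_2$. $X$ is strongly irreducible if it is $\Delta$-irreducible for some finite $\Delta \subset \mathbb{Z}$. *)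

(* Defs.v *)
From mathcomp Require Import all_boot all_order all_algebra.
From mathcomp Require Import all_classical all_reals all_analysis.

Set Implicit Arguments.
Unset Strict Implicit.
Unset Printing Implicit Defensive.

Import GRing.Theory.

Local Open Scope classical_set_scope.
Local Open Scope ring_scope.

(* [discrete_topology A] is a copy of [A] carrying the discrete topology;
   [{ptws _ -> _}] carries the product topology. *)
Notation configuration A := {ptws int -> discrete_topology A}.

Definition shift_action (A : finType) (g : int) (x : configuration A) :
  configuration A := fun h => x (h - g).

Definition shift_invariant (A : finType) (X : set (configuration A)) : Prop :=
  forall (g : int) (x : configuration A), X x -> X (shift_action g x).

Definition subshift (A : finType) (X : set (configuration A)) : Prop :=
  closed X /\ shift_invariant X.

(* The word x(1) x(2) ... x(n). *)
Definition word_of (A : finType) (x : configuration A) (n : nat) : seq A :=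
  [seq x (Posz i) | i <- iota 1 n].

(* Elements of the free monoid over [A] are sequences. The empty word belongs
   to the language exactly when [X] is nonempty. *)
Definition language (A : finType) (X : set (configuration A)) : set (seq A) :=
  [set u | exists x n, X x /\ u = word_of x n].

(* Omega^{+Delta} *)
Definition plus_set (Omega Delta : set int) : set int :=
  [set g | [set g + d | d in Delta] `&` Omega !=set0].

Definition irreducible_wrt (A : finType) (Delta : set int)
    (X : set (configuration A)) : Prop :=
  forall Omega1 Omega2 : set int,
    finite_set Omega1 -> finite_set Omega2 ->
    plus_set Omega1 Delta `&` Omega2 = set0 ->
    forall x1 x2 : configuration A, X x1 -> X x2 ->
    exists x : configuration A,
      [/\ X x, (forall g, Omega1 g -> x g = x1 g) &
          (forall g, Omega2 g -> x g = x2 g)].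

Definition strongly_irreducible (A : finType) (X : set (configuration A)) :
  Prop := exists Delta : set int, finite_set Delta /\ irreducible_wrt Delta X.

(* Main.v *)
(** (b) => (a): if Delta is the integer interval from [- N0] to [N0], then
Delta-separated sets [O1], [O2] are at distance more than [N0]. One builds
configurations that are correct on longer and longer intervals: if the last
point lies in [O1], let [j] be the last point of [O2]; a configuration correct
up to [j] is kept up to [j] and glued to [x1] across a gap of length [N0],
which [O1] does not meet. No limit is needed, because the sets to be
matched are finite. *)
Require Import Defs.
From mathcomp Require Import all_boot all_order all_algebra.
From mathcomp Require Import all_classical all_reals all_analysis.
From mathcomp Require Import zify.

Set Implicit Arguments.
Unset Strict Implicit.
Unset Printing Implicit Defensive.

Import Order.TTheory GRing.Theory Num.Theory.

Local Open Scope classical_set_scope.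
Local Open Scope ring_scope.

Section Words.
Variable A : finType.
Implicit Types (x y : configuration A) (n m : nat).

Lemma size_word_of x n : size (word_of x n) = n.
Proof. by rewrite size_map size_iota. Qed.

Lemma eq_word_of x y n :
  word_of x n = word_of y n <-> forall i : int, 0 < i <= n%:Z -> x i = y i.
Proof.
split=> [/eq_in_map exy [] // i /andP[i0 iN]|exy]; last first.
  by apply/eq_in_map => i; rewrite mem_iota => i_in; apply: exy; lia.
by apply: exy; rewrite mem_iota; lia.
Qed.

Lemma word_of_cat x n m :
  word_of x (n + m) = word_of x n ++ word_of (shift_action (- n%:Z) x) m.
Proof.
rewrite /word_of iotaD map_cat; congr (_ ++ _).
rewrite addnC iotaDl -map_comp; apply: eq_map => i /=.
by rewrite /shift_action; congr (x _); lia.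
Qed.

Lemma word_of_prefix x (u v : seq A) n :
  word_of x n = u ++ v -> u = word_of x (size u).
Proof.
move=> e; have en : n = (size u + size v)%N.
  by rewrite -size_cat -e size_word_of.
by move/eqP: e; rewrite en word_of_cat eqseq_cat ?size_word_of // => /andP[/eqP].
Qed.

Lemma word_of_suffix x (u v : seq A) n : word_of x n = u ++ v ->
  v = word_of (shift_action (- (size u)%:Z) x) (size v).
Proof.
move=> e; have en : n = (size u + size v)%N.
  by rewrite -size_cat -e size_word_of.
by move/eqP: e; rewrite en word_of_cat eqseq_cat ?size_word_of // => /andP[_ /eqP].
Qed.

End Words.

Section Gluing.
Variables (A : finType) (X : set (configuration A)).

(** The word condition in (b) for one length [N], put in terms of configurations. The base point [a]
    is arbitrary, so the gluing arguments below need neither words nor shifts. *)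
Definition gluing_gap (N : nat) : Prop :=
  forall x y : configuration A, X x -> X y -> forall (a : int) (n m : nat),
  exists z : configuration A, [/\ X z,
    forall i, a < i <= a + n%:Z -> z i = x i &
    forall i, a + n%:Z + N%:Z < i <= a + n%:Z + N%:Z + m%:Z -> z i = y i].

Hypothesis X_shift : shift_invariant X.

Lemma gluing_gap_language (N : nat) : gluing_gap N <->
  forall u v : seq A, language X u -> language X v ->
  exists w : seq A, size w = N /\ language X (u ++ w ++ v).
Proof.
split=> [glue _ _ [x [n [Xx ->]]] [y [m [Xy ->]]]|glue x y Xx Xy a n m].
  (* Shifting [y] by [n + N] moves its letters at [1..m] to the right-hand block. *)
  have [z [Xz zx zy]] :=
    glue x _ Xx (X_shift (n%:Z + N%:Z) Xy) 0 n m.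
  exists (word_of (shift_action (- n%:Z) z) N); split; first exact: size_word_of.
  exists z, (n + (N + m))%N; split=> //.
  rewrite !word_of_cat; congr (_ ++ (_ ++ _)); apply/eq_word_of => i i_in.
    by rewrite zx //; lia.
  rewrite /shift_action zy; last by lia.
  by rewrite /shift_action; congr (y _); lia.
(* Both blocks are moved back to start at position 1, where words are read; the glued configuration
   is then shifted forward by [a]. *)
pose x' := shift_action (- a) x.
pose y' := shift_action (- (a + n%:Z + N%:Z)) y.
have [w [sw [z [k [Xz]]]]] : exists w : seq A, size w = N /\
    language X (word_of x' n ++ w ++ word_of y' m).
  by apply: glue; eexists; eexists; split=> //; exact: X_shift.
move=> /esym e.
exists (shift_action a z); split; first exact: X_shift.
  move=> i i_in; move/word_of_prefix: (e).
  rewrite size_word_of => /eq_word_of /(_ (i - a)) ex.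
  transitivity (x' (i - a)); first by rewrite ex //; lia.
  by rewrite /x' /shift_action; congr (x _); lia.
move=> i i_in; move: e; rewrite catA => /word_of_suffix.
rewrite size_cat !size_word_of sw.
move=> /eq_word_of /(_ (i - (a + n%:Z + N%:Z))) ey.
transitivity (y' (i - (a + n%:Z + N%:Z))).
  by rewrite ey /shift_action; [congr (z _)|]; lia.
by rewrite /y' /shift_action; congr (y _); lia.
Qed.

Lemma finite_int_bounded (D : set int) : finite_set D ->
  exists M : nat, forall d, D d -> (absz d <= M)%N.
Proof.
move=> /finite_seqP[s ->]; exists (\max_(d <- s) absz d)%N => d /= ds.
by apply: (@leq_bigmax_seq _ s xpredT absz).
Qed.

Lemma finite_int_interval (a b : int) : finite_set [set i | a <= i <= b].
Proof.
apply: (@sub_finite_set _ _ ((fun k : nat => a + k%:Z) @` `I_(absz (b - a)).+1)).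
  move=> i /= i_in; exists (absz (i - a)); [rewrite /=|]; lia.
exact/finite_image/finite_II.
Qed.

(** Points of the two blocks differ by more than [N], hence by more than any element of [D]. This
    works for every [N] above [M], so [M] can serve as the [N0] of (b). *)
Lemma irreducible_gluing_gap (D : set int) (M N : nat) :
  (forall d, D d -> (absz d <= M)%N) -> (M <= N)%N ->
  irreducible_wrt D X -> gluing_gap N.
Proof.
move=> DM MN irrX x y Xx Xy a n m.
have [|||z [Xz zx zy]] := irrX [set i | a + 1 <= i <= a + n%:Z]
  [set i | a + n%:Z + N%:Z + 1 <= i <= a + n%:Z + N%:Z + m%:Z] _ _ _ x y Xx Xy.
- exact: finite_int_interval.
- exact: finite_int_interval.
- apply/eqP/negPn/negP => /set0P[g [[_ [[d /DM dM <-]] /=]]]; lia.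
by exists z; split=> // i i_in; [apply: zx|apply: zy] => /=; lia.
Qed.

Definition agrees_upto (O : set int) (a : int) (n : nat)
  (x z : configuration A) : Prop :=
  forall i, a < i <= a + n%:Z -> O i -> z i = x i.

(** The induction step when the last point lies in [O1]; it is also applied with the two sets
    exchanged. *)
Lemma glue_last_point (N : nat) (O1 O2 : set int) (x1 x2 : configuration A)
    (a : int) (n : nat) :
  gluing_gap N -> X x1 ->
  (forall g h, O1 g -> O2 h -> (N < absz (g - h)%R)%N) ->
  (forall k, (k <= n)%N -> exists z,
    [/\ X z, agrees_upto O1 a k x1 z & agrees_upto O2 a k x2 z]) ->
  O1 (a + n.+1%:Z) ->
  exists z, [/\ X z, agrees_upto O1 a n.+1 x1 z & agrees_upto O2 a n.+1 x2 z].
Proof.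
move=> glue Xx1 sep IH nO1.
(* The maximal such [k] is the offset of the last point of [O2]. Admitting 0 makes it exist always:
   the maximum is 0 when [O2] misses the window, and then [x1] itself works. *)
pose P k := (k < n.+2)%N && `[< k = 0%N \/ O2 (a + k%:Z) >].
have exP : exists k, P k by exists 0%N; apply/andP; split=> //; apply/asboolP; left.
have ubP k : P k -> (k <= n.+1)%N by move=> /andP[].
have [j /andP[jn /asboolP Pj] jmax] := ex_maxnP exP ubP.
have O2j i : a + j%:Z < i <= a + n.+1%:Z -> ~ O2 i.
  move=> i_in O2i.
  have : P (absz (i - a)).
    apply/andP; split; first by lia.
    apply/asboolP; right.
    by rewrite (_ : a + _ = i) //; lia.
  by move/jmax; lia.
case: (posnP j) => [j0|j_gt0].
  exists x1; split=> // i i_in O2i.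
  by case: (O2j i) => //; rewrite j0; lia.
have {}Pj : O2 (a + j%:Z) by case: Pj => // j0; rewrite j0 in j_gt0.
(* Separation gives [j + N < n.+1]: the hypothesis applies to [j], and the subtraction below is not
   truncated, so the right block ends at the last point. *)
have jn' := sep _ _ nO1 Pj.
have [z' [Xz' z'1 z'2]] : exists z,
    [/\ X z, agrees_upto O1 a j x1 z & agrees_upto O2 a j x2 z].
  by apply: IH; lia.
have [z [Xz zz' zx1]] := glue z' x1 Xz' Xx1 a j (n.+1 - (j + N))%N.
exists z; split=> // i i_in Oi.
  (* By separation from [a + j], a point of [O1] beyond [a + j] is also beyond the gap. *)
  have sepi := sep _ _ Oi Pj.
  have [ij|ji] := leP i (a + j%:Z); last by apply: zx1; lia.
  rewrite zz'; last by lia.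
  by apply: z'1 => //; lia.
have [ij|ji] := leP i (a + j%:Z); last by case: (O2j i) => //; lia.
rewrite zz'; last by lia.
by apply: z'2 => //; lia.
Qed.

(** The induction on [n] is strong because gluing falls back to the last point of the other set,
    which may be far to the left. *)
Lemma glue_separated (N : nat) (O1 O2 : set int) (x1 x2 : configuration A)
    (a : int) (n : nat) :
  gluing_gap N -> X x1 -> X x2 ->
  (forall g h, O1 g -> O2 h -> (N < absz (g - h)%R)%N) ->
  exists z, [/\ X z, agrees_upto O1 a n x1 z & agrees_upto O2 a n x2 z].
Proof.
move=> glue Xx1 Xx2 sep; elim/ltn_ind: n => -[_|n IH].
  by exists x1; split=> // i; lia.
have [nO1|nO1] := pselect (O1 (a + n.+1%:Z)).
  by apply: (glue_last_point glue Xx1 sep _ nO1) => k kn; exact: IH.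
have [nO2|nO2] := pselect (O2 (a + n.+1%:Z)).
  have [|k kn|z [Xz z2 z1]] :=
    @glue_last_point N O2 O1 x2 x1 a n glue Xx2 _ _ nO2; last by exists z.
    by move=> g h O2g O1h; have := sep _ _ O1h O2g; lia.
  by have [z [Xz z1 z2]] := IH k kn; exists z.
have [z [Xz z1 z2]] := IH n (ltnSn n).
exists z; split=> // i i_in Oi.
  have [e|ne] := eqVneq i (a + n.+1%:Z); first by rewrite e in Oi.
  by apply: z1 => //; lia.
have [e|ne] := eqVneq i (a + n.+1%:Z); first by rewrite e in Oi.
by apply: z2 => //; lia.
Qed.

Lemma gluing_gap_irreducible (N : nat) : gluing_gap N ->
  irreducible_wrt [set d | - N%:Z <= d <= N%:Z] X.
Proof.
move=> glue O1 O2 finO1 finO2 disj x1 x2 Xx1 Xx2.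
have sep g h : O1 g -> O2 h -> (N < absz (g - h)%R)%N.
  move=> O1g O2h; rewrite ltnNge; apply/negP => gh.
  (* If the distance were at most [N], then [h + (g - h) = g] would put [h] in the enlarged [O1]. *)
  suff : (plus_set O1 [set d | - N%:Z <= d <= N%:Z] `&` O2) h by rewrite disj.
  split=> //; exists g; split=> //; exists (g - h); [rewrite /=|]; lia.
have [M1 O1M] := finite_int_bounded finO1.
have [M2 O2M] := finite_int_bounded finO2.
(* The window is open on the left, so it runs exactly from [- (M1 + M2)] to [M1 + M2] and contains
   both sets. *)
have [z [Xz z1 z2]] := glue_separated (- (M1 + M2)%:Z - 1)
  (M1 + M2 + M1 + M2).+1 glue Xx1 Xx2 sep.
exists z; split=> // g Og; [apply: z1|apply: z2] => //.
  by have := O1M _ Og; lia.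
by have := O2M _ Og; lia.
Qed.

End Gluing.

Theorem proposition1p2 (A : finType) (X : set (configuration A))
    (hX : subshift X) :
  strongly_irreducible X <->
  exists N0 : nat,
    forall u v : seq A, language X u -> language X v ->
    forall N : nat, (N0 <= N)%N ->
    exists w : seq A, size w = N /\ language X (u ++ w ++ v).
Proof.
have [_ X_shift] := hX; split=> [[D [finD irrX]]|[N0 glueX]].
  have [M DM] := finite_int_bounded finD.
  exists M => u v Lu Lv N MN.
  have glue := irreducible_gluing_gap DM MN irrX.
  exact: (proj1 (gluing_gap_language X_shift N) glue).
exists [set d | - N0%:Z <= d <= N0%:Z]; split; first exact: finite_int_interval.
apply: gluing_gap_irreducible; apply/(gluing_gap_language X_shift) => u v Lu Lv.
exact: glueX.
Qed.
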